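(* Let $\mathcal{C}_2$ be the family of all finite chains of the poset $(\mathbb{N}\times\mathbb{N},\le)$, where $(n_0,m_0)\le(n_1,m_1)$ iff $n_0\le n_1$ and $m_0\le m_1$. Then $\mathcal{C}_2$ satisfies property $(S)$ but does not satisfy property $(S^* )$.
   Context: $\mathbb{N}=\{1,2,\dots\}$. Let $\Omega$ be a countably infinite set and $\mathcal{F}$ a family of finite subsets of $\Omega$ that is closed under subsets and has union $\Omega$. For $x\in\mathbb{R}^\Omega$ let $\|x\|_{\mathcal{F}}=\sup\{\sum_{i\in F}|x(i)|:F\in\mathcal{F}\}$, and let $X_{\mathcal{F}}$ be the Banach space of all $x\in\mathbb{R}^\Omega$ with $\inf\{\|P_{\Omega\setminus E}(x)\|_{\mathcal{F}}:E\subseteq\Omega\text{ finite}\}=0$, normed by $\|\cdot\|_{\mathcal{F}}$, where $P_A(x)$ agrees with $x$ on $A$ and is $0$ off $A$. The closure of $\mathcal{F}$ in $2^\Omega$ is $\overline{\mathcal{F}}=\mathcal{F}\cup\{A\subseteq\Omega: A\text{ infinite and every finite subset of }A\text{ is in }\mathcal{F}\}$. Property $(S)$: for every $\mathcal{F}$-supported normalized block basic sequence $(x_n)$ in $X_{\mathcal{F}}$ (that is, $\|x_n\|_{\mathcal{F}}=1$, $\mathrm{supp}(x_n)\in\mathcal{F}$ for all $n$, and the supports are pairwise disjoint) there is a $D\in\overline{\mathcal{F}}$ with $\limsup_{n\to\infty}\|P_D(x_n)\|_{\mathcal{F}}>0$. Property $(S^* )$: for every sequence $(F_n)$ of pairwise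 disjoint elements of $\mathcal{F}$ there is a finite $\mathcal{D}\subseteq\overline{\mathcal{F}}$ such that $F_n\subseteq\bigcup\mathcal{D}$ for infinitely many $n$. (In this definition the $F_n$ are understood to be non-empty.) *)

(* Defs.v *)
From HB Require Import structures.
From mathcomp Require Import all_boot all_order all_algebra.
From mathcomp Require Import finmap.
From mathcomp Require Import all_classical all_reals all_analysis.
Set Implicit Arguments.
Unset Strict Implicit.
Unset Printing Implicit Defensive.
Import Order.TTheory GRing.Theory Num.Theory.
Import numFieldNormedType.Exports.
Local Open Scope classical_set_scope.
Local Open Scope ring_scope.

Section Family.
Context {T : choiceType}.
Implicit Types (F : set (set T)) (A D : set T).

(* Presupposed by the notions below, which are written for an arbitrary
   family of sets; see [chains2_standing]. *)
Definition standing_family F :=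
  [/\ countable [set: T] /\ infinite_set [set: T],
      F `<=` finite_set,
      forall A B, A `<=` B -> F B -> F A &
      \bigcup_(A in F) A = [set: T]].

(* For a standing family this is the closure in [2^T], see
   [family_closureE]. *)
Definition family_closure F : set (set T) :=
  F `|` [set A | infinite_set A /\
                 forall E, finite_set E -> E `<=` A -> F E].

Definition set_indic A : {ptws T -> bool} := fun t => `[< A t >].

Lemma family_closureE F : standing_family F ->
  family_closure F = [set A | closure (set_indic @` F) (set_indic A)].
Proof.
move=> [_ Ffin Fsub _]; apply/seteqP; split=> A /=.
  case=> [FA|[Ainf AF]]; first by apply: subset_closure; exists A.
  pose G := filter_from [set E | finite_set E /\ E `<=` A]
    (fun E => [set X | [/\ finite_set X, E `<=` X & X `<=` A]]).
  have GF : ProperFilter G.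
    apply: filter_from_proper; last first.
      by move=> E [Ef EA]; exists E; split.
    apply: filter_from_filter; first by exists set0; split; [exact: finite_set0|].
    move=> E1 E2 [f1 s1] [f2 s2]; exists (E1 `|` E2).
      by split; [rewrite finite_setU|rewrite subUset].
    by move=> X [Xf]; rewrite subUset => -[? ?] XA.
  apply: (@closed_cvg _ {ptws T -> bool} G GF set_indic
    (closure (set_indic @` F))) => //.
  - exact: closed_closure.
  - exists set0; first by split; [exact: finite_set0|].
    move=> X [Xf _ XA]; apply: subset_closure.
    by exists X => //; exact: AF.
  - apply/cvg_sup => t U [V [[W _ <-] WA] /= WU].
    suff Gt : G (set_indic @^-1` [set g | g t = set_indic A t]).
      by apply: filterS Gt => X /= Xt; apply: WU; rewrite /= Xt.
    have [At|nAt] := pselect (A t).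
      exists [set t]; first by split=> // x ->.
      move=> X [_ tX _] /=; rewrite /set_indic.
      by rewrite !asboolT //; exact: tX.
    exists set0; first by split; [exact: finite_set0|].
    by move=> X [_ _ XA] /=; rewrite /set_indic !asboolF // => /XA.
move=> clA.
have AF E : finite_set E -> E `<=` A -> F E.
  move=> Ef EA.
  pose f (t : T) := [set g : {ptws T -> bool} | g t = set_indic A t].
  have : nbhs (set_indic A) (\bigcap_(t in [set` fset_set E]) f t).
    apply: filter_bigI => t _.
    exact: (@proj_continuous T (fun=> bool) t (set_indic A) _
      (discrete_set1 _)).
  move=> /clA[_ [[B FB <-]] Bf].
  apply: Fsub FB => t Et.
  have := Bf t; rewrite /= in_fset_set // mem_set // => /(_ isT).
  by rewrite /f /= /set_indic (asboolT (EA _ Et)) => /asboolP.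
have [Af|Ainf] := pselect (finite_set A); last by right.
by left; exact: AF.
Qed.

Section Norm.
Context {R : realType}.
Implicit Types x : T -> R.

Definition fnorm F x : \bar R :=
  ereal_sup [set (\sum_(i \in E) `|x i|)%:E | E in F].

Definition coord_proj A x : T -> R := patch (fun=> 0) A x.

Definition supp x : set T := [set i | x i != 0].

Definition XF F : set (T -> R) :=
  [set x | ereal_inf [set fnorm F (coord_proj (~` E) x) | E in finite_set] = 0%E].

Definition normalized_block F (x : nat -> T -> R) :=
  [/\ forall n, XF F (x n),
      forall n, fnorm F (x n) = 1%E,
      forall n, F (supp (x n)) &
      trivIset [set: nat] (fun n => supp (x n))].
End Norm.

Definition property_S (R : realType) F :=
  forall x : nat -> T -> R, normalized_block F x ->
    exists2 D, family_closure F D &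
      (0 < limn_esup (fun n => fnorm F (coord_proj D (x n))))%E.

Definition property_Sstar F :=
  forall G : nat -> set T,
    (forall n, F (G n)) -> (forall n, G n !=set0) -> trivIset [set: nat] G ->
    exists DD : set (set T),
      [/\ finite_set DD, DD `<=` family_closure F &
          infinite_set [set n | G n `<=` \bigcup_(D in DD) D]].
End Family.

Definition pnat := {n : nat | (0 < n)%N}.

Definition le2 (p q : pnat * pnat) : Prop :=
  (val p.1 <= val q.1)%N /\ (val p.2 <= val q.2)%N.

Definition chains2 : set (set (pnat * pnat)) :=
  [set A | finite_set A /\ total_on A le2].

Lemma chains2_standing : standing_family chains2.
Proof.
split.
- split; first exact: countableP.
  move=> fT; apply: infinite_nat.
  pose f (p : pnat * pnat) := (val p.1).-1.
  have -> : [set: nat] = f @` [set: pnat * pnat].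
    apply/seteqP; split=> // n _.
    by exists (exist _ n.+1 (ltn0Sn n), exist _ n.+1 (ltn0Sn n)).
  exact: finite_image.
- by move=> A [].
- move=> A B AB [fB tB]; split; first exact: sub_finite_set fB.
  by move=> p q /AB Bp /AB Bq; exact: tB.
- apply/seteqP; split=> // p _; exists [set p] => //.
  by split=> // _ _ -> ->; left; split.
Qed.

(* Main.v *)
Require Import Defs.
From mathcomp Require Import all_boot all_order all_algebra.
From mathcomp Require Import all_classical all_reals all_analysis lra.

(**
(S): ||P_A(x_n)|| is subadditive in A. If (S) fails for (x_n), every row and
every column D has ||P_D(x_n)|| -> 0, hence so does every finite union of
them, in particular the set of points having a coordinate <= k. So one can
choose n_0 < n_1 < ... inductively such that, k_j being a bound for the
coordinates of the supports of x_0, ..., x_(n_j), the vector x_(n_(j+1)) has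
norm >= 1/2 on the quadrant of points with both coordinates > k_j. The parts
of the supports in these quadrants lie above each other, so their union is a
chain D, which contradicts the failure of (S).

(S-star) fails for the vertical segments F_n = {n} x {1, ..., n}: among
infinitely many of them one finds, for each K, an antichain
(n_0, K + 1), (n_1, K), ..., (n_K, 1) with K < n_0 < ... < n_K, which no K
chains can cover.
*)

Set Implicit Arguments.
Unset Strict Implicit.
Unset Printing Implicit Defensive.
Import Order.TTheory GRing.Theory Num.Theory.
Local Open Scope classical_set_scope.

Section NormTheory.
Context {T : choiceType} {R : realType}.
Implicit Types (F : set (set T)) (x y z : T -> R) (A B : set T).

Lemma le_fnorm F x y : F `<=` finite_set -> (forall i, `|x i| <= `|y i|)%R ->
  (fnorm F x <= fnorm F y)%E.
Proof.
move=> Ffin xy; apply: ge_ereal_sup => _ [E FE <-].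
apply: le_ereal_sup_tmp; exists (\sum_(i \in E) `|y i|)%R%:E; first by exists E.
rewrite lee_fin !fsbig_finite; [|exact: Ffin..].
by apply: ler_sum => i _.
Qed.

Lemma le_fnormD F x y z : F `<=` finite_set ->
  (forall i, `|x i| <= `|y i| + `|z i|)%R ->
  (fnorm F x <= fnorm F y + fnorm F z)%E.
Proof.
move=> Ffin xyz; apply: ge_ereal_sup => _ [E FE <-].
apply: (@le_trans _ _ ((\sum_(i \in E) `|y i|)%R%:E +
                       (\sum_(i \in E) `|z i|)%R%:E)%E).
  rewrite -EFinD lee_fin !fsbig_finite; [|exact: Ffin..].
  by rewrite -big_split /=; apply: ler_sum => i _.
by apply: leeD; apply: ereal_sup_ubound; exists E.
Qed.

Lemma coord_proj_setT x : coord_proj setT x = x.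
Proof. by apply/funext => i; rewrite /coord_proj patchE in_setT. Qed.

(** Intersecting with the support allows a whole quadrant to be compared with a chain that contains
    only its support points. *)
Lemma le_fnorm_coord_proj F A B x : F `<=` finite_set -> A `&` supp x `<=` B ->
  (fnorm F (coord_proj A x) <= fnorm F (coord_proj B x))%E.
Proof.
move=> Ffin AB; apply: le_fnorm => // i; rewrite /coord_proj !patchE.
case: ifPn => [/set_mem Ai|_]; last by rewrite normr0.
have [->|xi] := eqVneq (x i) 0%R; first by rewrite normr0.
by rewrite mem_set //; apply: AB.
Qed.

Lemma fnorm_coord_projU F A B x : F `<=` finite_set ->
  (fnorm F (coord_proj (A `|` B) x) <=
   fnorm F (coord_proj A x) + fnorm F (coord_proj B x))%E.
Proof.
move=> Ffin; apply: le_fnormD => // i; rewrite /coord_proj !patchE in_setU.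
by case: (i \in A); case: (i \in B);
  rewrite /= ?normr0 ?addr0 ?add0r// lerDl.
Qed.

End NormTheory.

Section LimnEsup.
Context {R : realType}.
Implicit Type u : nat -> \bar R.

Lemma limn_esup_ge u (e : \bar R) :
  (forall n, exists2 m, (n <= m)%N & (e <= u m)%E) -> (e <= limn_esup u)%E.
Proof.
move=> ue; apply: le_ereal_inf_tmp => _ [V [N _ NV] <-].
have [m Nm em] := ue N.
by apply: le_ereal_sup_tmp; exists (u m) => //; exists m => //; exact: NV.
Qed.

Lemma limn_esup_le0P u : ~ (0 < limn_esup u)%E ->
  forall e : R, (0 < e)%R -> exists N, forall n, (N <= n)%N -> (u n <= e%:E)%E.
Proof.
move=> u0 e e0; apply: contrapT => /forallNP uN; apply: u0.
apply: (@lt_le_trans _ _ e%:E); first by rewrite lte_fin.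
apply: limn_esup_ge => n; have /existsNP[m /not_implyP[nm eum]] := uN n.
by exists m => //; rewrite ltW// ltNge; exact/negP.
Qed.

End LimnEsup.

Lemma increasing_iter (next : nat -> nat) n0 : (forall n, (n < next n)%N) ->
  {homo (fun i => iter i next n0) : i j / (i < j)%N}.
Proof.
by move=> nextP; apply: homo_ltn => [|i]; [exact: ltn_trans|exact: nextP].
Qed.

Lemma infinite_set_next (M : set nat) : infinite_set M ->
  forall n, exists m, (n < m)%N /\ M m.
Proof.
move=> Minf n; apply: contrapT => nM; apply: Minf.
apply: (sub_finite_set _ (finite_II n.+1)) => m Mm /=.
by rewrite ltnNge; apply/negP => nm; apply: nM; exists m.
Qed.

Lemma finite_set_bounded (T : choiceType) (A : set T) (f : T -> nat) :
  finite_set A -> exists b, forall t, A t -> (f t <= b)%N.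
Proof.
move=> /finite_seqP[s ->]; exists (\max_(t <- s) f t)%N => t /= ts.
exact: leq_bigmax_seq.
Qed.

(** Comparability involves two points at a time, so the finite subsets [[set p; q]] already decide
    it. *)
Lemma family_closure_chains2P (A : set (Defs.pnat * Defs.pnat)) :
  family_closure chains2 A <-> total_on A le2.
Proof.
split=> [[[]//|[_ AC]] p q Ap Aq|At].
  have [] := AC [set p; q].
  - by rewrite finite_setU; split; exact: finite_set1.
  - by move=> _ [->|->].
  - by move=> _; apply; [left|right].
have [Af|Ainf] := pselect (finite_set A); first by left.
right; split=> // E Ef EA; split=> // p q /EA Ap /EA Aq; exact: At.
Qed.

(* The complement of the quadrant to the upper right of [(k, k)]. *)
Definition slab (k : nat) : set (Defs.pnat * Defs.pnat) :=
  [set p | (val p.1 <= k)%N \/ (val p.2 <= k)%N].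

Lemma slab0 : slab 0 = set0.
Proof.
apply/seteqP; split=> // -[p q] /= [] /=.
  by rewrite leqNgt (valP p).
by rewrite leqNgt (valP q).
Qed.

(** Induction step for the slabs: only one column and one row are added, and both are chains. *)
Lemma slabS k : slab k.+1 =
  slab k `|` ([set p | val p.1 = k.+1] `|` [set p | val p.2 = k.+1]).
Proof.
rewrite /slab; apply/seteqP; split=> -[p q] /=.
  rewrite (leq_eqVlt (val p)) (leq_eqVlt (val q)) !ltnS.
  by case=> /orP[/eqP|] h; [right; left|left; left|right; right|left; right].
case=> [[] h|[->|->]]; first by left; exact: leqW.
- by right; exact: leqW.
- by left.
- by right.
Qed.

Lemma column_chain k :
  total_on [set p : Defs.pnat * Defs.pnat | val p.1 = k] le2.
Proof.
move=> p q /= pk qk; rewrite /le2 /= pk qk leqnn.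
by have /orP[|] := leq_total (val p.2) (val q.2); [left|right].
Qed.

Lemma row_chain k :
  total_on [set p : Defs.pnat * Defs.pnat | val p.2 = k] le2.
Proof.
move=> p q /= pk qk; rewrite /le2 /= pk qk leqnn.
by have /orP[|] := leq_total (val p.1) (val q.1); [left|right].
Qed.

(** A point off [slab (b j)] exceeds [b j] in both coordinates, hence lies above every earlier
    [S i]; within a single piece, [S j] itself is a chain. *)
Lemma bigcup_diff_slab_chain (S : nat -> set (Defs.pnat * Defs.pnat))
    (b : nat -> nat) :
  (forall j, total_on (S j) le2) ->
  (forall i j, (i < j)%N ->
     S i `<=` [set p | (val p.1 <= b j)%N /\ (val p.2 <= b j)%N]) ->
  total_on (\bigcup_j (S j `\` slab (b j))) le2.
Proof.
move=> St Sb.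
have lt_le2 i j p q : (i < j)%N -> S i p -> ~ slab (b j) q -> le2 p q.
  move=> ij /(Sb _ _ ij)[p1 p2] /not_orP[/negP q1 /negP q2].
  rewrite -!ltnNge in q1 q2.
  by split; [exact: leq_trans (ltnW q1)|exact: leq_trans (ltnW q2)].
move=> p q [i _ [Sp bp]] [j _ [Sq bq]].
have [ij|ji|ij] := ltngtP i j.
- by left; exact: lt_le2 ij Sp bq.
- by right; exact: lt_le2 ji Sq bp.
- by apply: (St j) => //; rewrite -ij.
Qed.

Lemma property_S_chains2 (R : realType) : property_S R chains2.
Proof.
move=> x [_ x1 xC _].
have [_ Cfin _ _] := chains2_standing.
pose N A n := fnorm chains2 (coord_proj A (x n)).
apply: contrapT => noD.
have chain_null A : total_on A le2 -> forall e : R, (0 < e)%R ->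
    exists M, forall n, (M <= n)%N -> (N A n <= e%:E)%E.
  move=> At; apply: limn_esup_le0P => NA; apply: noD; exists A => //.
  exact/family_closure_chains2P.
have slab_null k : forall e : R, (0 < e)%R ->
    exists M, forall n, (M <= n)%N -> (N (slab k) n <= e%:E)%E.
  (* Coordinates are positive, so the base case concerns the empty chain. *)
  elim: k => [|k IH] e e0; first by apply: chain_null; rewrite ?slab0.
  have e3 : (0 < e / 3)%R by rewrite divr_gt0.
  have [M MP] := IH _ e3.
  have [M1 M1P] := chain_null _ (@column_chain k.+1) _ e3.
  have [M2 M2P] := chain_null _ (@row_chain k.+1) _ e3.
  exists (maxn M (maxn M1 M2)) => n; rewrite !geq_max => /and3P[Mn M1n M2n].
  have -> : e = (e / 3 + (e / 3 + e / 3))%R.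
    by lra.
  rewrite slabS; apply: le_trans (fnorm_coord_projU _ _ _ Cfin) _.
  rewrite 2!EFinD; apply: leeD; first exact: MP.
  apply: le_trans (fnorm_coord_projU _ _ _ Cfin) _.
  by apply: leeD; [exact: M1P|exact: M2P].
have /choice[b bP] n : exists b, forall m, (m <= n)%N ->
    forall p, supp (x m) p -> (val p.1 <= b)%N /\ (val p.2 <= b)%N.
  have Ufin : finite_set (\bigcup_(m in `I_n.+1) supp (x m)).
    by apply: bigcup_finite => // m _; exact: Cfin.
  have [b bP] := finite_set_bounded (fun p => val p.1 + val p.2)%N Ufin.
  exists b => m mn p xp; have /bP pb : (\bigcup_(m in `I_n.+1) supp (x m)) p.
    by exists m.
  by split; apply: leq_trans pb; rewrite ?leq_addr ?leq_addl.
have /choice[next nextP] n : exists m,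
    (n < m)%N /\ (N (slab (b n)) m <= (1 / 2)%R%:E)%E.
  have [|M MP] := slab_null (b n) (1 / 2)%R; first by rewrite divr_gt0.
  by exists (maxn n.+1 M); rewrite leq_maxl MP ?leq_maxr.
pose s i := iter i next 0.
have s_lt : {homo s : i j / (i < j)%N}.
  by apply: increasing_iter => n; have [] := nextP n.
pose D := \bigcup_j (supp (x (s j.+1)) `\` slab (b (s j))).
apply: noD; exists D.
  apply/family_closure_chains2P; apply: bigcup_diff_slab_chain => [j|i j ij p].
    by have [] := xC (s j.+1).
  (* For [i < j], the piece [i] comes from the vector of index [s i.+1 <= s j], which [b (s j)]
     takes into account. *)
  apply: bP; move: ij; rewrite leq_eqVlt => /orP[/eqP->//|/s_lt]; exact: ltnW.
apply: (@lt_le_trans _ _ (1 / 2)%R%:E); first by rewrite lte_fin divr_gt0.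
apply: limn_esup_ge => n; exists (s n.+1).
  by elim: n => // n IH; apply: leq_ltn_trans IH _; exact: s_lt.
have [_ half_slab] := nextP (s n).
have half_quadrant : (N (~` slab (b (s n))) (s n.+1) <= N D (s n.+1))%E.
  by apply: le_fnorm_coord_proj => // p [np xp]; exists n.
have : (1 <= (1 / 2)%R%:E + N D (s n.+1))%E.
  rewrite -(x1 (s n.+1)) -[in leLHS](coord_proj_setT (x (s n.+1))).
  rewrite -(setUv (slab (b (s n)))).
  exact: le_trans (fnorm_coord_projU _ _ _ Cfin) (leeD _ _).
(* The value -oo contradicts the inequality, and +oo satisfies the bound trivially. *)
rewrite -/(N D (s n.+1)); case: (N D (s n.+1)) => [r| |] //.
  by rewrite -EFinD !lee_fin; lra.
by move=> _; exact: leey.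
Qed.

(** Indices start at 0 and coordinates at 1: this is {n + 1} x {1, ..., n + 1}. *)
Definition segment (n : nat) : set (Defs.pnat * Defs.pnat) :=
  (fun m => (exist _ n.+1 (ltn0Sn n), exist _ m.+1 (ltn0Sn m))) @` `I_n.+1.

Lemma segmentP n m : (m <= n)%N ->
  segment n (exist _ n.+1 (ltn0Sn n), exist _ m.+1 (ltn0Sn m)).
Proof. by move=> mn; exists m. Qed.

Lemma not_property_Sstar_chains2 : ~ property_Sstar chains2.
Proof.
move=> /(_ segment)[|||DD [DDfin DDcl DDinf]].
- move=> n; split; first exact/finite_image/finite_II.
  by move=> _ _ [m _ <-] [m' _ <-]; apply: (@column_chain n.+1).
- by move=> n; eexists; exact: (@segmentP n 0).
- by apply/trivIsetP => i j _ _ ij; apply/seteqP; split=> // p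
    [[m _ <-] [m' _ [ji]]]; move: ij; rewrite ji eqxx.
have /finite_setP[K /card_set_bijP[f [fK finj _]]] := DDfin.
have /choice[next nextP] := infinite_set_next DDinf.
(* Starting at [next K] makes [s 0] one of the covered indices and puts every [s i] beyond [K], so
   that the segments are tall enough. *)
pose s i := iter i next (next K).
have s_lt : {homo s : i j / (i < j)%N}.
  by apply: increasing_iter => n; have [] := nextP n.
have sK i : (K < s i)%N.
  elim: i => [|i IH]; first by have [] := nextP K.
  by apply: ltn_trans IH _; exact: s_lt.
have sM i : segment (s i) `<=` \bigcup_(D in DD) D.
  by case: i => [|i]; exact: (nextP _).2.
(* An antichain of [K.+1] points covered by the [K] chains of [DD]. *)
pose p i : Defs.pnat * Defs.pnat :=
  (exist _ (s i).+1 (ltn0Sn _), exist _ (K - i).+1 (ltn0Sn _)).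
have /choice[D DP] i : exists D, DD D /\ D (p i).
  have [|D DDD Dp] := sM i (p i); last by exists D.
  by apply: segmentP; rewrite (leq_trans (leq_subr _ _)) // ltnW.
(* From [p i] to [p j] the first coordinate grows and the second drops; [j <= K] keeps the truncated
   [K - i] strictly decreasing. *)
have anti i j : (i < j)%N -> (j <= K)%N -> D i <> D j.
  move=> ij jK Dij.
  have /family_closure_chains2P Dt := DDcl _ (DP j).1.
  have Di : D j (p i) by rewrite -Dij; exact: (DP i).2.
  have [[_]|[+ _]] := Dt _ _ Di (DP j).2; rewrite /= ltnS.
    by rewrite leqNgt ltn_sub2l ?(leq_trans ij).
  by rewrite leqNgt s_lt.
(* Distinct points need distinct chains, so [f \o D] would inject [K.+1] indices into [K] values. *)
have : (K.+1 <= K)%N.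
  apply: (@pigeonhole K.+1 K (f \o D)) => [i j /set_mem/= iK /set_mem/= jK|].
    move=> /finj; rewrite !inE => /(_ (DP i).1 (DP j).1) Dij.
    have [ij|ji|//] := ltngtP i j; first by case: (anti _ _ ij jK).
    by case: (anti _ _ ji iK).
  by move=> _ [i _ <-]; apply: fK; exact: (DP i).1.
by rewrite ltnn.
Qed.

Theorem proposition3p6 (R : realType) :
  property_S R chains2 /\ ~ property_Sstar chains2.
Proof.
by split; [exact: property_S_chains2|exact: not_property_Sstar_chains2].
Qed.
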